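(* Let $p$ be an odd prime and let $f:\mathbb{F}_{p^{2k}}\to\mathbb{F}_p$ satisfy Condition A with sign $\epsilon$. Let $D'_{\mathcal S}=\{x\in\mathbb{F}_{p^{2k}}^*: f(x)\text{ is a square in }\mathbb{F}_p\text{ (including }0)\}$. Then $D'_{\mathcal S}$ is a $(v,d,\lambda_1,\lambda_2)$ partial difference set in the additive group of $\mathbb{F}_{p^{2k}}$, where $v=p^{2k}$, $d=\frac12(p^k+p^{k-1}+2\epsilon)(p^k-\epsilon)$, $\lambda_1=\frac14(p^k+p^{k-1}+2\epsilon)^2-\frac{3\epsilon}{2}(p^k+p^{k-1}+2\epsilon)+\epsilon p^k$, $\lambda_2=\frac14(p^k+p^{k-1})(p^k+p^{k-1}+2\epsilon)$.
   Context: Let $\zeta_p$ be a primitive complex $p$-th root of unity and $\mathrm{tr}$ the absolute trace from $\mathbb{F}_{p^{2k}}$ to $\mathbb{F}_p$. For $f:\mathbb{F}_{p^{2k}}\to\mathbb{F}_p$ the Walsh transform is $\mathcal{W}_f(b)=\sum_{x\in\mathbb{F}_{p^{2k}}}\zeta_p^{f(x)+\mathrm{tr}(bx)}$. Condition A: $p$ is an odd prime and $f:\mathbb{F}_{p^{2k}}\to\mathbb{F}_p$ satisfies $f(0)=0$, $f(-x)=f(x)$ for all $x$; there is an integer $l$ with $\gcd(l-1,p-1)=1$ such that $f(\alpha x)=\alpha^l f(x)$ for all $\alpha\in\mathbb{F}_p$, $x\in\mathbb{F}_{p^{2k}}$; and there exist a constant $\epsilon\in\{1,-1\}$ and a function $f^*:\mathbb{F}_{p^{2k}}\to\mathbb{F}_p$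 such that $\mathcal{W}_f(b)=\epsilon p^k\zeta_p^{f^*(b)}$ for all $b\in\mathbb{F}_{p^{2k}}$. A $d$-subset $D$ of a finite abelian group $G$ (written additively, of order $v$) with $0\notin D$ is a $(v,d,\lambda,\mu)$ partial difference set if every nonzero element of $D$ can be written as $g-h$ with $g,h\in D$ in exactly $\lambda$ ways, and every nonzero element of $G\setminus D$ can be written so in exactly $\mu$ ways. *)

(* Defs.v *)
From HB Require Import structures.
From mathcomp Require Import all_boot all_order all_algebra all_field.
Unset Printing Implicit Defensive.
Import Order.TTheory GRing.Theory Num.Theory.
Local Open Scope ring_scope.

(* Absolute trace F_{p^(2k)} -> F_p : the unique a in 'F_p whose image in F
   equals sum_{i < 2k} x^(p^i) (this sum lies in the prime field when
   F has characteristic p and order p^(2k)). *)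
Definition abs_tr (p k : nat) (F : finFieldType) (x : F) : 'F_p :=
  odflt 0 [pick a : 'F_p | ((val a)%:R : F) == \sum_(i < 2 * k) x ^+ (p ^ i)].

Definition walsh (p k : nat) (F : finFieldType) (z : algC) (f : F -> 'F_p)
  (b : F) : algC :=
  \sum_(x : F) z ^+ (val (f x + abs_tr p k F (b * x))).

(* Condition A (p odd prime, F of order p^(2k) and characteristic p assumed
   separately). Elements alpha of F_p act on F via alpha%:R. *)
Definition conditionA (p k : nat) (F : finFieldType) (z : algC)
  (f : F -> 'F_p) (eps : int) : Prop :=
  [/\ f 0 = 0,
      (forall x, f (- x) = f x),
      (exists l : int, gcdz (l - 1) (p.-1)%:Z = 1%N /\
         forall (alpha : 'F_p) (x : F),
           f (((val alpha)%:R : F) * x) = alpha ^ l * f x),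
      (eps = 1 \/ eps = -1) &
      (exists fstar : F -> 'F_p, forall b : F,
         walsh p k F z f b = (eps%:~R * (p ^ k)%N%:R) * z ^+ (val (fstar b)))].

(* (v, d, lambda, mu) partial difference set in a finite abelian group G;
   parameters given as rationals (they are given by rational formulas). *)
Definition is_pds (G : finZmodType) (D : {set G}) (v d lam mu : rat) : Prop :=
  [/\ (#|G|%:R : rat) = v,
      (#|D|%:R : rat) = d,
      0 \notin D,
      (forall g, g != 0 -> g \in D ->
         (#|[set u : G * G | (u.1 \in D) && (u.2 \in D) && (u.1 - u.2 == g)]|%:R : rat) = lam) &
      (forall g, g != 0 -> g \notin D ->
         (#|[set u : G * G | (u.1 \in D) && (u.2 \in D) && (u.1 - u.2 == g)]|%:R : rat) = mu)].

Definition DS (p : nat) (F : finFieldType) (f : F -> 'F_p) : {set F} :=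
  [set x : F | (x != 0) && [exists y : 'F_p, f x == y ^+ 2]].

(* Main.v *)
Require Import Defs.
From HB Require Import structures.
From mathcomp Require Import all_boot all_order all_algebra all_field.
From mathcomp Require Import ring.
Import Order.TTheory GRing.Theory Num.Theory.
Local Open Scope ring_scope.

(* By Galois conjugation, the flat Walsh transform of f and the homogeneity
   f(a x) = a^l f(x) give
     sum_x chi(c^(1-l) f(x) + tr(b x)) = eps p^k chi(c f*(b))   for c != 0,
   and c |-> c^(1-l) permutes F_p^*. As l is even, c^(1-l) and c have the same
   quadratic character, so expanding "f(x) is a square" in additive characters
   shows that the transform of D at b != 0 depends only on whether f*(b) is a
   square. At b = 0 one needs f*(0) = 0, which follows by parity: x |-> -x makes
   every level set of f even, except the one containing 0. The resulting two
   values are the roots of X^2 = (d - mu) + (lam - mu) X, so Fourier inversion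
   yields the difference counts. *)

(** * Orthogonality of additive characters *)

Lemma sum_add_char (G : finZmodType) (R : idomainType) (c : G -> R) (g : G) :
  {morph c : x y / x + y >-> x * y} -> c g != 1 -> \sum_x c x = 0.
Proof.
move=> cD cg1; apply/eqP.
have: (c g - 1) * \sum_x c x == 0.
  rewrite mulrBl mul1r subr_eq0 mulr_sumr eq_sym; apply/eqP.
  rewrite (reindex_inj (addrI g)) /=.
  by apply: eq_bigr => x _; rewrite cD.
by rewrite mulf_eq0 subr_eq0 (negPf cg1).
Qed.

Lemma add_char_orthogonality (F : finFieldType) (R : idomainType) (c : F -> R)
    (g y : F) :
  {morph c : x y / x + y >-> x * y} -> c 0 = 1 -> c g != 1 ->
  \sum_x c (x * y) = (#|F| * (y == 0%R))%N%:R.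
Proof.
move=> cD c0 cg1; have [->|y0] := eqVneq y 0.
  by rewrite (eq_bigr (fun=> 1)) ?sumr_const ?muln1 // => x _; rewrite mulr0.
rewrite muln0 (reindex_inj (mulIf (invr_neq0 y0))) /=.
rewrite (eq_bigr c); first exact: sum_add_char cg1.
by move=> x _; rewrite mulfVK.
Qed.

(** * Partial difference sets recognised by their character sums *)

Lemma card_pairs (G : finZmodType) (D : {set G}) (R : pzSemiRingType) (g : G) :
  #|[set u : G * G | (u.1 \in D) && (u.2 \in D) && (u.1 - u.2 == g)]|%:R =
  \sum_(x in D) \sum_(y in D) (x - y == g)%:R :> R.
Proof.
rewrite -sum1_card natr_sum pair_big /= [RHS]big_mkcond [LHS]big_mkcond /=.
by apply: eq_bigr => -[x y] _; rewrite inE /=; case: (_ \in D) (_ \in D) (_ == _) => [] [] [].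
Qed.

(* The spectral hypothesis is the Fourier transform of the identity
   1_D * 1_(-D) = (d - mu) delta_0 + (lam - mu) 1_D + mu. *)
Lemma pds_of_spectrum (F : finFieldType) (psi : F -> algC) (h : F)
    (D : {set F}) (lam mu : rat) :
  {morph psi : x y / x + y >-> x * y} -> psi 0 = 1 -> psi h != 1 ->
  0 \notin D -> (forall x, x \in D -> - x \in D) ->
  (forall b, (\sum_(x in D) psi (b * x)) ^+ 2 =
     ratr (#|D|%:R - mu) + ratr (lam - mu) * \sum_(x in D) psi (b * x)
     + ratr mu * (#|F| * (b == 0%R))%N%:R) ->
  is_pds F D #|F|%:R #|D|%:R lam mu.
Proof.
move=> psiD psi0 psih D0 DN specD.
have orth y : \sum_b psi (b * y) = (#|F| * (y == 0%R))%N%:R.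
  exact: add_char_orthogonality psih.
have F_neq0 : #|F|%:R != 0 :> algC.
  by rewrite pnatr_eq0 -lt0n; apply/card_gt0P; exists 0.
have cnt g : g != 0 ->
    (#|[set u : F * F | (u.1 \in D) && (u.2 \in D) && (u.1 - u.2 == g)]|%:R : algC)
    = ratr ((lam - mu) * (g \in D)%:R + mu).
  move=> g0; apply: (mulfI F_neq0); rewrite card_pairs.
  (* With S(b) the transform of D, evaluate the sum over b of psi(-bg) S(b)^2 in two ways:
     orthogonality gives |F| times the count, and [specD] gives the closed form. *)
  transitivity (\sum_b psi (b * - g) * (\sum_(x in D) psi (b * x)) ^+ 2).
    transitivity (\sum_(x in D) \sum_(y in D) \sum_b psi (b * (x - y - g))).
      rewrite mulr_sumr; apply: eq_bigr => x _; rewrite mulr_sumr.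
      by apply: eq_bigr => y _; rewrite orth subr_eq0 natrM.
    under eq_bigr do rewrite exchange_big /=.
    rewrite exchange_big /=; apply: eq_bigr => b _.
    (* As D = -D, one factor S(b) can be read with -x, so that differences x - y appear. *)
    have SN : \sum_(x in D) psi (b * x) = \sum_(x in D) psi (b * - x).
      rewrite (reindex_inj oppr_inj) /=; apply: eq_bigl => x.
      by apply/idP/idP => /DN; rewrite ?opprK.
    rewrite expr2 {2}SN mulr_suml mulr_sumr; apply: eq_bigr => x _.
    rewrite !mulr_sumr; apply: eq_bigr => y _.
    by rewrite -!psiD; congr psi; ring.
  (* The constant term of [specD] sums to 0 since g is nonzero, the linear one gives |F| times the
     indicator of D at g, and the last survives only at b = 0. *)
  under eq_bigr do rewrite specD !mulrDr.
  rewrite !big_split /= -mulr_suml orth oppr_eq0 (negPf g0) muln0 mul0r add0r.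
  rewrite addrC (bigD1 0) //= eqxx mul0r psi0 mul1r muln1 [X in _ + X + _]big1.
    rewrite addr0; under eq_bigr do rewrite mulrCA mulr_sumr.
    rewrite -mulr_sumr exchange_big /=.
    under eq_bigr => x _ do under eq_bigr do rewrite -psiD -mulrDr.
    under eq_bigr => x _ do rewrite orth addrC subr_eq0 natrM.
    rewrite -mulr_sumr [ratr (_ * _ + _)]rmorphD rmorphM /= ratr_nat.
    suff -> : \sum_(x in D) (x == g)%:R = (g \in D)%:R :> algC by ring.
    case: (boolP (g \in D)) => gD.
      rewrite (bigD1 g) //= eqxx big1 ?addr0 // => x /andP[_ /negPf->].
      by [].
    by rewrite big1 // => x xD; case: eqP gD => // <-; rewrite xD.
  by move=> b /negPf->; rewrite muln0 !mulr0.
split=> // g g0 gD; have := cnt g g0; rewrite -(ratr_nat algC) => /fmorph_inj ->.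
  by rewrite gD mulr1 subrK.
by rewrite (negPf gD) mulr0 add0r.
Qed.

(** * Embedding of the prime field and the absolute trace *)

Section PrimeField.

Variables (p : nat) (p_pr : prime p).

Lemma val_FpD (a b : 'F_p) : val (a + b) = ((val a + val b) %% p)%N.
Proof. by rewrite -val_Fp_nat // natrD !natr_Zp. Qed.

Lemma val_FpM (a b : 'F_p) : val (a * b) = ((val a * val b) %% p)%N.
Proof. by rewrite -val_Fp_nat // natrM !natr_Zp. Qed.

Lemma ltn_Fp (a : 'F_p) : (val a < p)%N.
Proof. by rewrite -[X in (_ < X)%N](Fp_cast p_pr) ltn_ord. Qed.

Section Embedding.

Variables (F : finFieldType) (pcharF : p \in [pchar F]).

Lemma Fp_embD (a b : 'F_p) :
  (val (a + b))%:R = (val a)%:R + (val b)%:R :> F.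
Proof. by rewrite val_FpD GRing.natr_mod_pchar // natrD. Qed.

Lemma Fp_embM (a b : 'F_p) :
  (val (a * b))%:R = (val a)%:R * (val b)%:R :> F.
Proof. by rewrite val_FpM GRing.natr_mod_pchar // natrM. Qed.

Lemma Fp_emb_eq0 (a : 'F_p) : ((val a)%:R == 0 :> F) = (a == 0).
Proof.
rewrite -(dvdn_pcharf pcharF) -val_eqE /=; case: (posnP (val a)) => [->|a_gt0].
  by rewrite dvdn0.
by rewrite gtnNdvd ?ltn_Fp // gtn_eqF.
Qed.

Lemma Fp_emb_inj : injective (fun a : 'F_p => (val a)%:R : F).
Proof.
move=> a b eq_ab; apply/eqP; rewrite -subr_eq0 -Fp_emb_eq0.
by rewrite -(inj_eq (addIr (val b)%:R)) -Fp_embD subrK add0r eq_ab.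
Qed.

Lemma Fp_emb_exp (a : 'F_p) (i : nat) :
  ((val a)%:R : F) ^+ (p ^ i) = (val a)%:R.
Proof.
elim: i => [|i IHi]; first by rewrite expn0.
by rewrite expnSr exprM IHi -(pFrobenius_autE pcharF) pFrobenius_aut_nat.
Qed.

(** X^p - X has at most p roots, and the p images of ['F_p] already are roots. *)
Lemma Fp_emb_fixed (s : F) : s ^+ p = s -> exists a : 'F_p, (val a)%:R = s.
Proof.
move=> sp; suff: [exists a : 'F_p, (val a)%:R == s].
  by case/existsP=> a /eqP; exists a.
apply: contraT => /existsPn s_nemb.
pose P : {poly F} := 'X^p - 'X.
have szP : size P = p.+1.
  by rewrite size_polyDl size_polyXn // size_polyN size_polyX ltnS prime_gt1.
have rootP x : root P x = (x ^+ p == x).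
  by rewrite rootE /P hornerD hornerN hornerXn hornerX subr_eq0.
suff: (size (s :: [seq (val a)%:R | a : 'F_p]) < size P)%N.
  by rewrite szP /= size_map -cardE card_Fp // ltnn.
apply: max_poly_roots.
- by rewrite -size_poly_eq0 szP.
- rewrite /= rootP sp eqxx /=; apply/allP => _ /mapP[a _ ->].
  by rewrite rootP -[X in _ ^+ X]expn1 Fp_emb_exp.
rewrite /= map_inj_uniq ?enum_uniq ?andbT; last exact: Fp_emb_inj.
by apply/mapP => -[a _ s_a]; have := s_nemb a; rewrite /= -s_a eqxx.
Qed.

Variable k : nat.
Hypothesis card_F : #|F| = (p ^ (2 * k))%N.

Local Notation tr := (abs_tr p k F).

(** Frobenius shifts the terms cyclically because x^|F| = x; the sum is thus fixed, lies in the
    prime field, and [pick] succeeds. *)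
Lemma abs_trE (x : F) : (val (tr x))%:R = \sum_(i < 2 * k) x ^+ (p ^ i).
Proof.
rewrite /abs_tr; case: pickP => [a /eqP-> // | no_a].
set s := \sum_(i < _) _ in no_a *.
suff /Fp_emb_fixed[a a_s] : s ^+ p = s by have := no_a a; rewrite a_s eqxx.
rewrite -(pFrobenius_autE pcharF) rmorph_sum /=.
case: (posnP (2 * k)) => [k0|]; first by rewrite /s k0 !big_ord0.
case Dn: (2 * k)%N => [//|n] _; rewrite /s Dn big_ord_recr big_ord_recl /= addrC.
rewrite pFrobenius_autE -exprM -expnSr -Dn -card_F expf_card expn0 expr1.
by congr (_ + _); apply: eq_bigr => i _; rewrite pFrobenius_autE -exprM -expnSr.
Qed.

Lemma abs_trD : {morph tr : x y / x + y}.
Proof.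
move=> x y; apply: Fp_emb_inj; rewrite /= Fp_embD !abs_trE -big_split /=.
apply: eq_bigr => i _; elim: (i : nat) => [|j IHj]; first by rewrite expn0 !expr1.
by rewrite expnSr !exprM IHj -!(pFrobenius_autE pcharF) rmorphD.
Qed.

Lemma abs_trM (a : 'F_p) (x : F) : tr ((val a)%:R * x) = a * tr x.
Proof.
apply: Fp_emb_inj; rewrite /= Fp_embM !abs_trE mulr_sumr.
by apply: eq_bigr => i _; rewrite exprMn Fp_emb_exp.
Qed.

(** The trace is a nonzero polynomial of degree at most p^(2k-1), too small to vanish on all of
    F. *)
Lemma abs_tr_neq0 : exists x, tr x != 0.
Proof.
apply/existsP; apply: contraT => /existsPn tr0.
case Dn: (2 * k)%N => [|n].
  by have := finNzRing_gt1 F; rewrite card_F Dn.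
pose P : {poly F} := \sum_(i < n.+1) 'X^(p ^ i).
have szP : (size P <= (p ^ n).+1)%N.
  apply: leq_trans (size_sum _ _ _) _; apply/bigmax_leqP => i _.
  by rewrite size_polyXn ltnS leq_exp2l ?prime_gt1 // -ltnS.
have P0 : P != 0.
  (* The coefficient of X is 1: only i = 0 contributes to it. *)
  apply/eqP => /(congr1 (fun Q : {poly F} => Q`_1)); rewrite coef0 coef_sum.
  rewrite big_ord_recl /= coefXn expn0 eqxx big1 ?addr0 => [/eqP|i _].
    by rewrite oner_eq0.
  by rewrite coefXn ltn_eqF // -(expn0 p) ltn_exp2l ?prime_gt1.
have rootsP : all (root P) (enum F).
  apply/allP => x _; rewrite rootE horner_sum.
  under eq_bigr do rewrite hornerXn.
  by rewrite -Dn -abs_trE Fp_emb_eq0 -[_ == _]negbK tr0.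
have := leq_trans (max_poly_roots P0 rootsP (enum_uniq _)) szP.
by rewrite -cardE card_F Dn ltnS leq_exp2l ?prime_gt1 // ltnn.
Qed.

End Embedding.

(** * Additive characters of the prime field *)

Variables (z : algC) (z_prim : p.-primitive_root z).

Definition Fp_char (a : 'F_p) : algC := z ^+ val a.

Lemma Fp_charD : {morph Fp_char : a b / a + b >-> a * b}.
Proof. by move=> a b; rewrite /Fp_char val_FpD (prim_expr_mod z_prim) exprD. Qed.

Lemma Fp_char0 : Fp_char 0 = 1.
Proof. by []. Qed.

Lemma Fp_char_eq1 (a : 'F_p) : (Fp_char a == 1) = (a == 0).
Proof.
rewrite -(prim_order_dvd z_prim) -val_eqE /=; case: (posnP (val a)) => [->|a_gt0].
  by rewrite dvdn0.
by rewrite gtnNdvd ?ltn_Fp // gtn_eqF.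
Qed.

Lemma sum_Fp_char (y : 'F_p) :
  \sum_a Fp_char (a * y) = (p * (y == 0%R))%N%:R.
Proof.
rewrite (@add_char_orthogonality _ _ _ 1) ?card_Fp //; first exact: Fp_charD.
by rewrite Fp_char_eq1 oner_eq0.
Qed.

Lemma sum_Fp_char_neq0 (y : 'F_p) :
  \sum_(a | a != 0) Fp_char (a * y) = (p * (y == 0%R))%N%:R - 1.
Proof. by rewrite -sum_Fp_char [in RHS](bigD1 0) //= mul0r Fp_char0 addrC addrK. Qed.

(** The Galois automorphism of the p-th cyclotomic field sending z to z^b, extended to [algC]. *)
Lemma Fp_char_aut (b : 'F_p) : b != 0 ->
  exists u : {rmorphism algC -> algC}, forall a, u (Fp_char a) = Fp_char (b * a).
Proof.
move=> b0; have co_b : coprime (val b) p.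
  rewrite coprime_sym prime_coprime // gtnNdvd ?ltn_Fp // lt0n.
  by rewrite -val_eqE in b0.
have [u uE] := Qn_aut_exists co_b; exists u => a.
rewrite /Fp_char val_FpM (prim_expr_mod z_prim) exprM rmorphXn /= uE //.
exact: prim_expr_order z_prim.
Qed.

End PrimeField.

(** * Squares and power maps in finite fields *)

Lemma card_symmetric_set (F : finFieldType) (A : {set F}) :
  2%:R != 0 :> F -> 0 \notin A -> (forall x, x \in A -> - x \in A) ->
  #|A| = (2 * #|[set x ^+ 2 | x in A]|)%N.
Proof.
(* The fibres of squaring on A are the pairs {w, -w}, and w != -w since w and 2 are nonzero. *)
move=> two_neq0 A0 AN; rewrite -sum1_card (partition_big_imset (fun x => x ^+ 2)).
rewrite mulnC -sum_nat_const; apply: eq_bigr => _ /imsetP[w wA ->].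
have /negPf w_neq : w != - w.
  rewrite -subr_eq0 opprK -mulr2n -mulr_natr mulf_neq0 //.
  by apply: contraNneq A0 => <-.
rewrite sum1dep_card (_ : [set _ | _] = [set w; - w]) ?cards2 ?w_neq //.
apply/setP => x; rewrite !inE eqf_sqr; apply/andb_idl.
by case/pred2P=> -> //; apply: AN.
Qed.

Definition is_square (F : finFieldType) (t : F) := [exists y, t == y ^+ 2].

Lemma is_square_sqr (F : finFieldType) (y : F) : is_square F (y ^+ 2).
Proof. by apply/existsP; exists y. Qed.

Lemma is_square0 (F : finFieldType) : is_square F 0.
Proof. by have := is_square_sqr F 0; rewrite expr0n. Qed.

Lemma is_square_mul_sqr (F : finFieldType) (w t : F) :
  w != 0 -> is_square F (w ^+ 2 * t) = is_square F t.
Proof.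
move=> w0; apply/existsP/existsP => -[y /eqP ty].
  exists (w^-1 * y); rewrite exprMn -ty mulrA -exprMn mulVf //.
  by rewrite expr1n mul1r.
by exists (w * y); rewrite ty exprMn.
Qed.

Lemma card_squares (F : finFieldType) : 2%:R != 0 :> F ->
  (2 * #|is_square F| = #|F|.+1)%N.
Proof.
move=> two_neq0.
have := card_symmetric_set F [set~ 0] two_neq0.
rewrite cardsC1 !inE eqxx => /(_ isT) card_sq.
have sqE : [set x ^+ 2 | x in [set~ 0]] = [set t | is_square F t] :\ 0 :> {set F}.
  apply/setP => t; rewrite !inE; apply/imsetP/andP => [[x]|[t0 /existsP[y /eqP ty]]].
    by rewrite !inE => x0 ->; rewrite expf_neq0 ?is_square_sqr.
  by exists y; rewrite // !inE; apply: contraNneq t0 => y0; rewrite ty y0 expr0n.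
have -> : #|is_square F| = #|[set t | is_square F t]| by rewrite cardsE.
rewrite (cardsD1 0) inE is_square0 mulnDr -sqE.
rewrite -card_sq => [|x]; last by rewrite !inE oppr_eq0.
by rewrite -(ltn_predK (finNzRing_gt1 F)).
Qed.

(** On nonzero elements a Bezout coefficient u of m inverts the power map, as w^(|F|-1) = 1; for m
    != 0 only 0 is sent to 0. *)
Lemma expz_coprime_inj (F : finFieldType) (m : int) :
  m != 0 -> gcdz m (#|F|.-1)%:Z = 1%N -> injective (fun x : F => x ^ m).
Proof.
move=> m0 co_m x y /= exy.
have [x0|x0] := eqVneq x 0.
  apply/esym/eqP; move/eqP: exy; rewrite x0 exp0rz (negPf m0) eq_sym.
  by rewrite expfz_eq0 m0.
have y0 : y != 0.
  apply: contraNneq x0 => y0; move/eqP: exy; rewrite y0 exp0rz (negPf m0).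
  by rewrite expfz_eq0 m0.
have [u [v uv]] := Bezoutz m (#|F|.-1)%:Z.
have {}uv : u * m + v * (#|F|.-1)%:Z = 1 by rewrite uv co_m.
have powE (w : F) : w != 0 -> w = (w ^ m) ^ u.
  move=> w0; have w1 : w ^+ #|F|.-1 = 1.
    apply: (mulfI w0); rewrite -exprS (ltn_predK (finNzRing_gt1 F)) mulr1.
    exact: expf_card.
  rewrite -[LHS]expr1z -uv expfzDr // [v * _]mulrC -!exprz_exp.
  by rewrite -exprnP w1 exp1rz mulr1 !exprz_exp mulrC.
by rewrite (powE x) // (powE y) // exy.
Qed.

(** * Level sets of a homogeneous even function with flat Walsh transform *)

Section BentLevelSets.

Variables (p k : nat) (F : finFieldType) (z : algC) (f : F -> 'F_p) (l : int).
Variables (W : algC) (fstar : F -> 'F_p).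
Hypotheses (p_pr : prime p) (p_odd : odd p) (card_F : #|F| = (p ^ (2 * k))%N).
Hypotheses (pcharF : p \in [pchar F]) (z_prim : p.-primitive_root z).
Hypotheses (f0 : f 0 = 0) (fN : forall x, f (- x) = f x).
Hypothesis l_coprime : gcdz (l - 1) (p.-1)%:Z = 1%N.
Hypothesis f_homog : forall (a : 'F_p) x, f ((val a)%:R * x) = a ^ l * f x.
(** [W] stands for eps p^k; as an integer it is unchanged by Galois conjugation. *)
Hypothesis W_fixed : forall u : {rmorphism algC -> algC}, u W = W.
Hypothesis walsh_f : forall b, walsh p k F z f b = W * z ^+ val (fstar b).

Local Notation tr := (abs_tr p k F).
Local Notation chi := (Fp_char p z).
Local Notation Sq := (is_square 'F_p).

Let trD := abs_trD p p_pr F pcharF k card_F.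
Let trM := abs_trM p p_pr F pcharF k card_F.
Let chiD := Fp_charD p p_pr z z_prim.

Lemma two_neq0_pchar (R : finFieldType) : p \in [pchar R] -> 2%:R != 0 :> R.
Proof.
move=> pcharR; rewrite -(dvdn_pcharf pcharR) dvdn_prime2 //.
by apply: contraTneq p_odd => ->.
Qed.

Lemma tr0 : tr 0 = 0.
Proof. by apply: (addrI (tr 0)); rewrite -trD !addr0. Qed.

Lemma chi_bent_scale (a : 'F_p) (b : F) : a != 0 ->
  \sum_x chi (a * (f x + tr (b * x))) = W * chi (a * fstar b).
Proof.
move=> a0; have [u uE] := Fp_char_aut p p_pr z z_prim a a0.
rewrite -uE -[W in RHS](W_fixed u) -rmorphM -walsh_f rmorph_sum; apply: eq_bigr => x _.
by rewrite -uE.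
Qed.

(** Substituting a x for x turns a^(1-l) f(x) into a f(x) and pulls a out of the trace. *)
Lemma chi_bent_power (a : 'F_p) (b : F) : a != 0 ->
  \sum_x chi (a ^ (1 - l) * f x + tr (b * x)) = W * chi (a * fstar b).
Proof.
move=> a0; have a0F : (val a)%:R != 0 :> F by rewrite Fp_emb_eq0.
rewrite -chi_bent_scale // (reindex_inj (mulfI a0F)) /=.
apply: eq_bigr => x _; congr chi.
rewrite f_homog mulrA -expfzDr // subrK expr1z mulrDr -trM.
by rewrite mulrCA.
Qed.

(** Expand the indicator of f(x) = t in characters; a = 0 gives |F| and the other a give Walsh
    values at b = 0. *)
Lemma card_level_set (t : 'F_p) :
  (p * #|[set x | f x == t]|)%N%:R =
  #|F|%:R + W * ((p * (fstar 0%R == t))%N%:R - 1) :> algC.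
Proof.
transitivity (\sum_a \sum_x chi (a * (f x - t))).
  rewrite exchange_big /= -sum1_card big_distrr /= natr_sum big_mkcond /=.
  apply: eq_bigr => x _; rewrite sum_Fp_char // subr_eq0 inE.
  by case: eqP; rewrite ?muln1 ?muln0.
rewrite (bigD1 0) //=; congr (_ + _).
  by under eq_bigr do rewrite mul0r Fp_char0; rewrite sumr_const.
rewrite -[fstar 0 == t]subr_eq0 -(sum_Fp_char_neq0 p p_pr z z_prim) mulr_sumr; apply: eq_bigr => a a0.
rewrite mulrBr chiD mulrA -chi_bent_scale // mulr_suml; apply: eq_bigr => x _.
by rewrite mul0r tr0 addr0 -chiD mulrBr.
Qed.

(* x |-> -x acts on the level sets of f, and 0 is its only fixed point. *)
Lemma odd_card_level_set (t : 'F_p) : odd #|[set x | f x == t]| = (t == 0).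
Proof.
have fS : forall x, x \in [set x | f x == t] :\ 0 -> - x \in [set x | f x == t] :\ 0.
  by move=> x; rewrite !inE oppr_eq0 fN.
rewrite (cardsD1 0) (card_symmetric_set F _ _ _ fS) ?two_neq0_pchar ?inE ?eqxx //.
by rewrite oddD f0 oddM addbF [0 == t]eq_sym; case: (t == 0).
Qed.

(** All level sets other than the one at c = [fstar 0] have equal size. If c != 0, those at 0 and -c
    would both be among them, yet their parities differ. *)
Lemma fstar0 : fstar 0 = 0.
Proof.
apply: contraTeq isT => c0; have cN : fstar 0 != - fstar 0.
  rewrite -subr_eq0 opprK -mulr2n -mulr_natr mulf_neq0 //.
  exact: two_neq0_pchar (pchar_Fp p_pr).
have: #|[set x | f x == 0]| = #|[set x | f x == - fstar 0]|.
  apply/eqP; rewrite -(eqn_pmul2l (prime_gt0 p_pr)) -(eqr_nat algC).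
  by rewrite !card_level_set (negPf c0) (negPf cN).
by move=> /(congr1 odd); rewrite !odd_card_level_set oppr_eq0 (negPf c0) eqxx.
Qed.

Lemma sum_square_indicator (s : 'F_p) :
  \sum_(t | Sq t) (p * (s == t))%N%:R = (p * Sq s)%N%:R :> algC.
Proof.
case: (boolP (Sq s)) => sqs.
  rewrite (bigD1 s) //= eqxx big1 ?addr0 // => t /andP[_].
  by rewrite eq_sym => /negPf->; rewrite muln0.
rewrite big1 ?muln0 // => t; case: eqP => [<-|]; last by rewrite muln0.
by rewrite (negPf sqs).
Qed.

(* Substituting a = c^(1-l) turns the Galois conjugates of the Walsh transform
   into the characters of fstar b; c^(1-l) and c differ by the square c^(-l). *)
Lemma square_preimage_transform (b : F) :
  p%:R * \sum_(x | Sq (f x)) chi (tr (b * x)) =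
  #|Sq|%:R * (#|F| * (b == 0%R))%N%:R + W * (p%:R * (Sq (fstar b))%:R - #|Sq|%:R).
Proof.
(* For l = 1 the gcd would be p - 1, which is at least 2. *)
have l1_neq0 : 1 - l != 0.
  rewrite -opprB oppr_eq0; apply: contra_eq_neq l_coprime => ->.
  by rewrite gcd0z; case: p p_pr p_odd => [|[|[|]]].
(* Since p - 1 is even, coprimality forces l - 1 to be odd. *)
have l_even : exists m, l = m + m.
  suff l2 : (2 %| l)%Z by exists (l %/ 2)%Z; rewrite -[LHS](divzK l2); ring.
  have : ~~ (2 %| l - 1)%Z.
    apply/negP => l1; have : (2 %| gcdz (l - 1) (p.-1)%:Z)%Z.
      rewrite dvdz_gcd l1 dvdzE /= dvdn2.
      by case: p p_pr p_odd => [|q] //= _.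
    by rewrite l_coprime.
  rewrite -eqz_mod_dvd => l1; apply/dvdz_mod0P; move: l1.
  have : (0 <= l %% 2)%Z by rewrite modz_ge0.
  have : (l %% 2 < 2)%Z by rewrite ltz_mod.
  by case: (l %% 2)%Z => [[|[|]]|].
transitivity (\sum_a \sum_(t | Sq t) \sum_x chi (a * f x + tr (b * x)) * chi (- (a * t))).
  rewrite exchange_big /=.
  transitivity (\sum_(t | Sq t) \sum_x \sum_a chi (a * (f x - t)) * chi (tr (b * x))).
    rewrite exchange_big /= mulr_sumr [LHS]big_mkcond /=; apply: eq_bigr => x _.
    rewrite -[LHS]mulrb; under eq_bigr do rewrite -mulr_suml sum_Fp_char // subr_eq0.
    by rewrite -mulr_suml sum_square_indicator -mulrnAl -mulrnA -mulr_natl.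
  apply: eq_bigr => t _; rewrite exchange_big /=; apply: eq_bigr => a _.
  by apply: eq_bigr => x _; rewrite -!chiD; congr chi; ring.
(* The term a = 0 gives the part supported at b = 0. *)
rewrite (bigD1 0) //=; congr (_ + _).
  have [h h0] := abs_tr_neq0 p p_pr F pcharF k card_F.
  rewrite -(@add_char_orthogonality _ _ (chi \o tr) h); first last.
  - by rewrite /= Fp_char_eq1.
  - by rewrite /= tr0.
  - by move=> x y; rewrite /= trD chiD.
  rewrite mulr_natl -sumr_const; apply: eq_bigr => t _; apply: eq_bigr => x _.
  by rewrite /= !mul0r add0r oppr0 Fp_char0 mulr1 mulrC.
rewrite (reindex_inj (expz_coprime_inj 'F_p (1 - l) l1_neq0 _)) /=; last first.
  by rewrite card_Fp // -opprB gcdNz.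
transitivity (\sum_(a | a != 0) \sum_(t | Sq t) W * chi (a * (fstar b - t))).
  apply: eq_big => [a|a]; rewrite expfz_eq0 (negPf l1_neq0) //= => a0.
  have al0 : a ^ l != 0 by rewrite expfz_neq0.
  (* Replace t by a^l t, which preserves squareness because l is even; then a^(1-l) t becomes a
     t. *)
  rewrite (reindex_inj (mulfI al0)) /=; apply: eq_big => t.
    have [m ->] := l_even; rewrite expfzDr // -expr2 is_square_mul_sqr //.
    by rewrite expfz_neq0.
  move=> _; rewrite mulrA -expfzDr // subrK expr1z -mulr_suml chi_bent_power //.
  by rewrite -mulrA -chiD; congr (_ * chi _); ring.
rewrite exchange_big /=.
under eq_bigr do rewrite -mulr_sumr sum_Fp_char_neq0 // subr_eq0.
by rewrite -mulr_sumr sumrB sum_square_indicator sumr_const natrM.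
Qed.

End BentLevelSets.

(** * Spectrum and parameters of the set of square values *)

Theorem theorem3 (p k : nat) (F : finFieldType) (z : algC)
  (f : F -> 'F_p) (eps : int) :
  prime p -> odd p ->
  #|F| = (p ^ (2 * k))%N -> (p \in [pchar F]) ->
  p.-primitive_root z ->
  conditionA p k F z f eps ->
  let e : rat := eps%:~R in
  let q : rat := (p ^ k)%N%:R in
  let q' : rat := (p ^ k.-1)%N%:R in
  is_pds F (DS p F f) (p ^ (2 * k))%N%:R
    (2^-1 * (q + q' + 2 * e) * (q - e))
    (4^-1 * (q + q' + 2 * e) ^+ 2 - (3 * e / 2) * (q + q' + 2 * e) + e * q)
    (4^-1 * (q + q') * (q + q' + 2 * e)).
Proof.
(* k = 0 would make F a single point; so k = k' + 1 and [k.-1] is a true predecessor. *)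
move=> p_pr p_odd; case: k => [|k'] card_F pcharF z_prim.
  by have := finNzRing_gt1 F; rewrite card_F.
set k := k'.+1 in card_F * => -[f0 fN [l [l_co f_homog]] eps1 [fstar walsh_f]].
move=> e q q'.
pose W : algC := eps%:~R * (p ^ k)%N%:R.
have W_fixed (u : {rmorphism algC -> algC}) : u W = W.
  by rewrite rmorphM /= rmorph_int rmorph_nat.
pose Sq := is_square 'F_p.
pose psi (x : F) := Fp_char p z (abs_tr p k F x).
have psi0 : psi 0 = 1 by rewrite /psi (tr0 p k F).
have psiD : {morph psi : x y / x + y >-> x * y}.
  by move=> x y; rewrite /psi abs_trD // Fp_charD.
have [h h0] := abs_tr_neq0 p p_pr F pcharF k card_F.
have psih : psi h != 1 by rewrite Fp_char_eq1.
have fstar00 : fstar 0 = 0.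
  exact: (fstar0 p k F z f W fstar p_pr p_odd card_F pcharF z_prim f0 fN W_fixed).
have two_sq : 2%:R * #|Sq|%:R = p%:R + 1 :> algC.
  rewrite -natrM card_squares ?card_Fp ?natr1 //.
  exact: two_neq0_pchar (pchar_Fp p_pr).
have p0 : p%:R != 0 :> algC by rewrite pnatr_eq0 -lt0n prime_gt0.
pose P : algC := p%:R; pose Q : algC := (p ^ k')%N%:R; pose E : algC := eps%:~R.
have qE : (p ^ k)%N%:R = P * Q by rewrite /k expnS natrM.
have vE : #|F|%:R = (P * Q) ^+ 2 by rewrite card_F mulnC expnM natrX qE.
(* Divide the transform of the square preimage by p and remove x = 0, where f(0) = 0 is a square;
   this accounts for the final -1. *)
have specE b : \sum_(x in DS p F f) psi (b * x) =
    (P + 1) / 2 * P * Q ^+ 2 * (b == 0)%:R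
    + E * Q * (P * (Sq (fstar b))%:R - (P + 1) / 2) - 1.
  have sqE : #|Sq|%:R = (P + 1) / 2 by rewrite /P -two_sq mulrC mulKf ?pnatr_eq0.
  have := square_preimage_transform p k F z f l W fstar p_pr p_odd card_F
    pcharF z_prim l_co f_homog W_fixed walsh_f b.
  rewrite (bigD1 0) /=; last by rewrite f0; exact: is_square0.
  rewrite mulr0 -/(psi 0) psi0 natrM vE -/Sq sqE /W qE -/P -/E => PS.
  rewrite (eq_bigl (fun x => is_square 'F_p (f x) && (x != 0))); last first.
    by move=> x; rewrite inE andbC.
  apply: (mulfI p0); rewrite -/P; apply: (addrI P).
  rewrite -[X in X + _]mulr1 -mulrDr PS; ring.
have E1 : E = 1 \/ E = -1 by rewrite /E; case: eps1 => ->; [left | right].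
have sq0 : Sq (fstar 0) by rewrite fstar00; exact: is_square0.
have eE : ratr e = E by rewrite ratr_int.
have {}qE : ratr q = P * Q by rewrite ratr_nat.
have q'E : ratr q' = Q by rewrite ratr_nat.
have ratrE := (rmorph1 (ratr : {rmorphism rat -> algC}),
  rmorphD (ratr : {rmorphism rat -> algC}), rmorphN (ratr : {rmorphism rat -> algC}),
  rmorphM (ratr : {rmorphism rat -> algC}), fmorphV (ratr : {rmorphism rat -> algC})).
clearbody e q q' P Q E.
(* The size of D is its transform at b = 0, where [fstar 0] = 0 counts as a square. *)
have cardD : #|DS p F f|%:R = 2^-1 * (q + q' + 2 * e) * (q - e).
  apply: (fmorph_inj (ratr : rat -> algC)); rewrite /= ratr_nat.
  transitivity (\sum_(x in DS p F f) psi (0 * x)).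
    by under eq_bigr do rewrite mul0r psi0; rewrite sumr_const.
  rewrite specE eqxx sq0 expr2 !ratrE /= eE qE q'E mulr1.
  by case: E1 => ->; field.
rewrite -card_F -cardD; apply: (pds_of_spectrum F psi h) => //.
- by rewrite inE eqxx.
- by move=> x; rewrite !inE oppr_eq0 fN.
(* It remains to check the quadratic at b = 0 and at the two values taken for b != 0, for each
   sign. *)
move=> b; rewrite cardD specE natrM vE (expr2 (_ + 2 * e)) !ratrE /= eE qE q'E.
have [->|_] := eqVneq b 0.
  by rewrite sq0 !mulr1; case: E1 => ->; field.
by rewrite !mulr0; case: (Sq _); case: E1 => ->; rewrite /= ?mulr0 ?mulr1; field.
Qed.
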